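(* Let $k,l$ be positive integers. For $n\ge 0$ let $q_n$ be the number of lattice paths from $(0,0)$ to $(ln,kn)$ that never go above the path $(N^kE^l)^n$, and let $w_1,\dots,w_l$ be the unique solutions (there are exactly $l$ of them) of the equation $$(w-1)^l - z\,w^{k+l} = 0$$ in the unknown $w$ that are fractional power series in $z$. Then the generating function $Q(z)=\sum_{n\ge 0} q_n z^n$ is given by $$Q(z) = \frac{-1}{z}\,(1-w_1)\cdots(1-w_l).$$
   Context: A lattice path is a finite sequence of steps, each being $N=(0,1)$ or $E=(1,0)$, starting at $(0,0)$. It is written as a word in the letters $N,E$; $N^k$ means $k$ consecutive $N$ steps, and $(N^kE^l)^n$ is the word $N^kE^l$ repeated $n$ times (a path from $(0,0)$ to $(ln,kn)$). For $n=0$ it is the empty path, and $q_0=1$. If $\pi$ and $P$ are lattice paths from $(0,0)$ to the same endpoint, $\pi$ never goes above $P$ if no point of $\pi$ lies strictly above $P$; equivalently, for every $i$, the number of $N$ steps among the first $i$ steps of $\pi$ is at most the number of $N$ steps among the first $i$ steps of $P$ (touching or sharing steps is allowed). Let $\mathbb{C}^{\mathrm{fra}}((z))$ be the field of fractional Laurent (Puiseux) series over $\mathbb{C}$, i.e. series of the form $\sum_{n\ge n_0} a_n z^{n/N}$ with $a_n\in\mathbb{C}$, $n_0\in\mathbb{Z}$ and $N$ a positive integer depending on the series (this $N$ is unrelated to the step $N$). A fractional power series is such a series with no negative powers of $z$, i.e. $n_0\ge 0$. The equation $(w-1)^l - z w^{k+l}=0$ has $k+l$ solutions in $\mathbb{C}^{\mathrm{fra}}((z))$,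 of which exactly $l$ are fractional power series. The identity for $Q(z)$ is an identity in this field. *)

(* Defs.v *)
From HB Require Import structures.
From mathcomp Require Import all_boot all_order all_algebra.
From mathcomp Require Import boolp classical_sets functions cardinality fsbigop.
From mathcomp Require Import reals.
From mathcomp Require Import complex.
From mathcomp Require Import zify ring.

Set Implicit Arguments.
Unset Strict Implicit.
Unset Printing Implicit Defensive.

Import Order.TTheory GRing.Theory Num.Theory.
Local Open Scope classical_set_scope.
Local Open Scope ring_scope.

(* [f r] is the coefficient of [z^r]; [n0] is a lower bound on the exponents in
   units of [1 / N]. *)
Definition fractional_laurent (K : fieldType) (f : rat -> K) : Prop :=
  exists (N : nat) (n0 : int), (0 < N)%N /\
    forall r : rat, f r != 0 ->
      exists2 n : int, n0 <= n & r = n%:~R / N%:R.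

Record puiseux (K : fieldType) := Puiseux {
  pcoef : rat -> K;
  pcoefP : fractional_laurent pcoef }.

HB.instance Definition _ (K : fieldType) := gen_eqMixin (puiseux K).
HB.instance Definition _ (K : fieldType) := gen_choiceMixin (puiseux K).

(* The sum has finite support when [f] and [g] are fractional Laurent series. *)
Definition conv (K : fieldType) (f g : rat -> K) (r : rat) : K :=
  \sum_(p \in [set: rat]) f p * g (r - p).

Section PuiseuxField.
Variable K : fieldType.
Implicit Types (f g h : rat -> K) (N M : nat) (m : int) (x y : puiseux K).

Lemma puiseux_ext x y : pcoef x =1 pcoef y -> x = y.
Proof.
case: x y => [f fP] [g gP] /= /funext fg; case: _ / fg gP => gP.
by congr Puiseux; exact: Prop_irrelevance.
Qed.

Definition gridpt N m (n : nat) : rat := (m%:~R + n%:R) / N%:R.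

Definition supported N m f :=
  forall r, f r != 0 -> exists n : nat, r = gridpt N m n.

Lemma gridpt_inj N m : (0 < N)%N -> injective (gridpt N m).
Proof.
move=> N0 i j; rewrite /gridpt => /(congr1 ( *%R^~ N%:R)).
have NN0 : N%:R != 0 :> rat by rewrite pnatr_eq0 -lt0n.
by rewrite !divfK // => /addrI /eqP; rewrite eqr_nat => /eqP.
Qed.

Lemma supported_laurent N m f :
  (0 < N)%N -> supported N m f -> fractional_laurent f.
Proof.
move=> N0 fS; exists N, m; split=> // r /fS[n ->]; exists (m + n%:Z).
  by rewrite lerDl.
by rewrite /gridpt intrD.
Qed.

Lemma laurent_supported f : fractional_laurent f ->
  exists N m, (0 < N)%N /\ supported N m f.
Proof.
case=> N [m [N0 fS]]; exists N, m; split=> // r /fS[n mn ->].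
exists `|n - m|%N; rewrite /gridpt; congr (_ / _).
rewrite pmulrn gez0_abs ?subr_ge0 // -intrD; congr (_%:~R); ring.
Qed.

Lemma supported_le N m m' f : m' <= m -> supported N m f -> supported N m' f.
Proof.
move=> mm fS r /fS[n ->]; exists (n + `|m - m'|)%N; rewrite /gridpt.
congr (_ / _); rewrite natrD (pmulrn _ `|m - m'|) gez0_abs ?subr_ge0 //.
rewrite intrB; ring.
Qed.

Lemma supported_mul N m M f : (0 < N)%N -> (0 < M)%N ->
  supported N m f -> supported (N * M) (m * M%:Z) f.
Proof.
move=> N0 M0 fS r /fS[n ->]; exists (n * M)%N; rewrite /gridpt.
have NN0 : N%:R != 0 :> rat by rewrite pnatr_eq0 -lt0n.
have MM0 : M%:R != 0 :> rat by rewrite pnatr_eq0 -lt0n.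
rewrite !natrM intrM -pmulrn; field; exact/andP.
Qed.

Lemma common2 f g : fractional_laurent f -> fractional_laurent g ->
  exists N m, [/\ (0 < N)%N, supported N m f & supported N m g].
Proof.
move=> /laurent_supported[N [m [N0 fS]]] /laurent_supported[M [m' [M0 gS]]].
exists (N * M)%N, (Num.min (m * M%:Z) (m' * N%:Z)); split.
- by rewrite muln_gt0 N0.
- by apply: supported_le (supported_mul N0 M0 fS); rewrite ge_min lexx.
- rewrite mulnC.
  by apply: supported_le (supported_mul M0 N0 gS); rewrite ge_min lexx orbT.
Qed.

Lemma common3 f g h : fractional_laurent f -> fractional_laurent g ->
  fractional_laurent h -> exists N m,
  [/\ (0 < N)%N, supported N m f, supported N m g & supported N m h].
Proof.
move=> fL gL /laurent_supported[M [m' [M0 hS]]].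
have [N [m [N0 fS gS]]] := common2 fL gL.
have mle : Num.min (m * M%:Z) (m' * N%:Z) <= m * M%:Z by rewrite ge_min lexx.
exists (N * M)%N, (Num.min (m * M%:Z) (m' * N%:Z)); split.
- by rewrite muln_gt0 N0.
- exact: supported_le (supported_mul N0 M0 fS).
- exact: supported_le (supported_mul N0 M0 gS).
- rewrite mulnC.
  by apply: supported_le (supported_mul M0 N0 hS); rewrite ge_min lexx orbT.
Qed.

Lemma supported_ext N m f g : supported N m f -> supported N m g ->
  (forall n, f (gridpt N m n) = g (gridpt N m n)) -> f =1 g.
Proof.
move=> fS gS fg r; have [fr0|/fS[n ->]] := eqVneq (f r) 0; last exact: fg.
by have [gr0|/gS[n ->]] := eqVneq (g r) 0; [rewrite fr0 gr0|exact: fg].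
Qed.

Lemma supported_conv N m m' f g : (0 < N)%N ->
  supported N m f -> supported N m' g -> supported N (m + m') (conv f g).
Proof.
move=> N0 fS gS r; apply: contraNP => nr; apply/eqP/fsbig1 => p _.
apply/eqP; rewrite mulf_eq0; apply/orP.
have [|/fS[i pE]] := eqVneq (f p) 0; first by left.
have [|/gS[j rE]] := eqVneq (g (r - p)) 0; first by right.
case: nr; exists (i + j)%N; rewrite -(subrK p r) rE pE /gridpt.
by rewrite intrD natrD; ring.
Qed.

Lemma conv_grid N m m' f g n : (0 < N)%N ->
  supported N m f -> supported N m' g ->
  conv f g (gridpt N (m + m') n) =
  \sum_(i < n.+1) f (gridpt N m i) * g (gridpt N m' (n - i)%N).
Proof.
move=> N0 fS gS.
have NN0 : N%:R != 0 :> rat by rewrite pnatr_eq0 -lt0n.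
have gE i : (i <= n)%N ->
    gridpt N (m + m') n - gridpt N m i = gridpt N m' (n - i)%N.
  by move=> lein; rewrite /gridpt natrB // intrD; field.
pose s := [seq gridpt N m i | i <- iota 0 n.+1].
have us : uniq s by rewrite map_inj_uniq ?iota_uniq //; exact: gridpt_inj.
rewrite /conv (fsbigE s) //; last first.
  move=> p _ ps; apply/eqP; rewrite mulf_eq0; apply/orP.
  have [|/fS[i pE]] := eqVneq (f p) 0; first by left.
  have [|/gS[j rE]] := eqVneq (g (gridpt N (m + m') n - p)) 0; first by right.
  case/negP: ps; rewrite pE; apply: map_f; rewrite mem_iota /= add0n ltnS.
  move: rE; rewrite pE => /eqP; rewrite subr_eq => /eqP rE.
  suff -> : n = (j + i)%N by rewrite leq_addl.
  apply: (@gridpt_inj N (m + m') N0).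
  by rewrite rE /gridpt intrD natrD; field.
rewrite big_map (eq_bigl xpredT); last by move=> i; rewrite /= in_setT.
rewrite -[iota 0 n.+1]/(index_iota 0 n.+1) big_mkord.
by apply: eq_bigr => i _; rewrite gE // -ltnS ltn_ord.
Qed.

Lemma conv_laurent f g :
  fractional_laurent f -> fractional_laurent g -> fractional_laurent (conv f g).
Proof.
move=> fL gL; have [N [m [N0 fS gS]]] := common2 fL gL.
exact: (supported_laurent N0 (supported_conv N0 fS gS)).
Qed.

Lemma zero_laurent : fractional_laurent (fun=> 0 : K).
Proof. by exists 1%N, 0; split=> // r; rewrite eqxx. Qed.

Lemma opp_laurent f : fractional_laurent f -> fractional_laurent (fun r => - f r).
Proof. by case=> N [m [N0 fS]]; exists N, m; split=> // r; rewrite oppr_eq0; exact: fS. Qed.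

Lemma supported_add N m f g : supported N m f -> supported N m g ->
  supported N m (fun r => f r + g r).
Proof.
move=> fS gS r; have [->|/fS //] := eqVneq (f r) 0.
by rewrite add0r => /gS.
Qed.

Lemma add_laurent f g : fractional_laurent f -> fractional_laurent g ->
  fractional_laurent (fun r => f r + g r).
Proof.
move=> fL gL; have [N [m [N0 fS gS]]] := common2 fL gL.
exact: (supported_laurent N0 (supported_add fS gS)).
Qed.

Lemma monomial_laurent (q : rat) :
  fractional_laurent (fun r => (r == q)%:R : K).
Proof.
exists `|denq q|%N, (numq q); split; first by rewrite absz_gt0 denq_neq0.
move=> r; case: (r =P q) => [-> _|_]; last by rewrite eqxx.
exists (numq q) => //; rewrite -{1}(divq_num_den q); congr (_ / _).
by rewrite pmulrn gez0_abs.
Qed.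

Definition pmono (q : rat) : puiseux K := Puiseux (monomial_laurent q).
Definition pzero : puiseux K := Puiseux zero_laurent.
Definition popp x : puiseux K := Puiseux (opp_laurent (pcoefP x)).
Definition padd x y : puiseux K := Puiseux (add_laurent (pcoefP x) (pcoefP y)).
Definition pmul x y : puiseux K := Puiseux (conv_laurent (pcoefP x) (pcoefP y)).

Lemma paddA : associative padd.
Proof. by move=> x y t; apply: puiseux_ext => r /=; rewrite addrA. Qed.
Lemma paddC : commutative padd.
Proof. by move=> x y; apply: puiseux_ext => r /=; rewrite addrC. Qed.
Lemma padd0 : left_id pzero padd.
Proof. by move=> x; apply: puiseux_ext => r /=; rewrite add0r. Qed.
Lemma paddN : left_inverse pzero popp padd.
Proof. by move=> x; apply: puiseux_ext => r /=; rewrite addNr. Qed.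

HB.instance Definition _ :=
  GRing.isZmodule.Build (puiseux K) paddA paddC padd0 paddN.

Lemma coefM_poly (a b : nat -> K) (d n : nat) : (n < d)%N ->
  ((\poly_(i < d) a i) * (\poly_(i < d) b i))`_n =
  \sum_(i < n.+1) a i * b (n - i)%N.
Proof.
move=> nd; rewrite coefM; apply: eq_bigr => i _; rewrite !coef_poly.
by rewrite !ifT //; have := ltn_ord i; lia.
Qed.

Lemma pmulC : commutative pmul.
Proof.
move=> x y; apply: puiseux_ext => /=.
have [N [m [N0 xS yS]]] := common2 (pcoefP x) (pcoefP y).
apply: (supported_ext (supported_conv N0 xS yS) (supported_conv N0 yS xS)) => n.
rewrite !conv_grid // (reindex_inj rev_ord_inj) /=; apply: eq_bigr => i _.
by rewrite mulrC subSS subKn // -ltnS.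
Qed.

Lemma pmulA : associative pmul.
Proof.
move=> x y t; apply: puiseux_ext => /=.
have [N [m [N0 xS yS tS]]] := common3 (pcoefP x) (pcoefP y) (pcoefP t).
have ytS := supported_conv N0 yS tS; have xyS := supported_conv N0 xS yS.
have xytS := supported_conv N0 xyS tS; rewrite -addrA in xytS.
apply: (supported_ext (supported_conv N0 xS ytS) xytS) => n.
rewrite conv_grid // addrA conv_grid //.
pose a i := pcoef x (gridpt N m i); pose b i := pcoef y (gridpt N m i).
pose c i := pcoef t (gridpt N m i); pose P (u : nat -> K) := \poly_(i < n.+1) u i.
transitivity (P a * (P b * P c))`_n.
  rewrite coefM; apply: eq_bigr => i _; have := ltn_ord i; rewrite ltnS => iN.
  rewrite coef_poly ltn_ord conv_grid // coefM_poly //; lia.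
rewrite mulrA coefM; apply: eq_bigr => i _; have := ltn_ord i; rewrite ltnS => iN.
rewrite coefM_poly ?ltn_ord // conv_grid // coef_poly ifT //; lia.
Qed.

Lemma pmul1 : left_id (pmono 0) pmul.
Proof.
move=> x; apply: puiseux_ext => r /=.
rewrite /conv (fsbigE [:: (0 : rat)]) //=; last first.
  by move=> p _; rewrite inE => /negPf ->; rewrite mul0r.
by rewrite big_mkcond big_seq1 in_setT eqxx mul1r subr0.
Qed.

Lemma pmulDl : left_distributive pmul +%R.
Proof.
move=> x y t; apply: puiseux_ext => /=.
have [N [m [N0 xS yS tS]]] := common3 (pcoefP x) (pcoefP y) (pcoefP t).
have xyS := supported_add xS yS.
apply: (supported_ext (supported_conv N0 xyS tS)
  (supported_add (supported_conv N0 xS tS) (supported_conv N0 yS tS))) => n.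
rewrite !conv_grid // -big_split; apply: eq_bigr => i _; exact: mulrDl.
Qed.

Lemma pone_neq0 : pmono 0 != 0.
Proof.
apply/eqP => /(congr1 (fun x => pcoef x 0)) /= /eqP.
by apply/negP; exact: oner_neq0.
Qed.

HB.instance Definition _ := GRing.Zmodule_isComNzRing.Build (puiseux K)
  pmulA pmulC pmul1 pmulDl pone_neq0.

Definition pinv x : puiseux K := xget 0 [set y | y * x = 1].

Fixpoint inv_coefs (a : nat -> K) (n : nat) : seq K :=
  if n is n'.+1 then
    let s := inv_coefs a n' in
    rcons s ((a 0%N)^-1 * ((n' == 0%N)%:R - \sum_(i < n') s`_i * a (n' - i)%N))
  else [::].

Lemma size_inv_coefs a n : size (inv_coefs a n) = n.
Proof. by elim: n => //= n IHn; rewrite size_rcons IHn. Qed.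

Lemma nth_inv_coefs a n i : (i < n)%N ->
  (inv_coefs a n)`_i = (inv_coefs a i.+1)`_i.
Proof.
elim: n => // n IHn; rewrite ltnS leq_eqVlt => /orP[/eqP -> //|lt_in].
by rewrite [LHS]/= nth_rcons size_inv_coefs lt_in IHn.
Qed.

Lemma inv_coefsP (a : nat -> K) : a 0%N != 0 -> exists b : nat -> K,
  forall n, \sum_(i < n.+1) b i * a (n - i)%N = (n == 0%N)%:R.
Proof.
move=> a0; exists (fun n => (inv_coefs a n.+1)`_n) => n.
rewrite big_ord_recr subnn [(inv_coefs a n.+1)]/= nth_rcons size_inv_coefs.
rewrite ltnn eqxx [X in _ + X = _]mulrAC mulVf // mul1r.
rewrite [X in X + _ = _](eq_bigr (fun i : 'I_n => (inv_coefs a n)`_i * a (n - i)%N)).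
  exact: subrKC.
by move=> i _; congr (_ * _); apply/esym/nth_inv_coefs.
Qed.

Lemma pinv_ex x : x != 0 -> exists y, y * x = 1.
Proof.
move=> x0; have [N [m [N0 xS]]] := laurent_supported (pcoefP x).
have exn : exists n, pcoef x (gridpt N m n) != 0.
  apply: contrapT => nex; case/eqP: x0; apply: puiseux_ext => r /=.
  have [//|xr] := eqVneq (pcoef x r) 0; case: nex.
  by have [n rE] := xS _ xr; exists n; rewrite -rE.
case: (ex_minnP exn) => d xd dmin.
have xS' : supported N (m + d%:Z) (pcoef x).
  move=> r xr; have [n rE] := xS _ xr; move: xr; rewrite rE => /dmin dn; exists (n - d)%N.
  by rewrite /gridpt natrB // intrD -pmulrn; congr (_ / _); ring.
set m' := m + d%:Z in xS'.
pose a i := pcoef x (gridpt N m' i).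
have a0 : a 0%N != 0.
  by rewrite /a /gridpt /m' intrD addr0.
have [b bP] := inv_coefsP a0.
pose g r : K := xget 0 [set c | exists2 n, r = gridpt N (- m') n & c = b n].
have gE n : g (gridpt N (- m') n) = b n.
  rewrite /g; case: xgetP => [c _ [k /(gridpt_inj N0) -> //]|/(_ (b n)) []].
  by exists n.
have gS : supported N (- m') g.
  by move=> r; rewrite /g; case: xgetP => [c _ [k -> _]|]; [exists k|rewrite eqxx].
exists (Puiseux (supported_laurent N0 gS)); apply: puiseux_ext => /=.
have oneS : supported N 0 (fun r => (r == 0)%:R : K).
  move=> r; case: (r =P 0) => [->|_]; last by rewrite eqxx.
  by exists 0%N; rewrite /gridpt addr0 mul0r.
have cS := supported_conv N0 gS xS'; rewrite addNr in cS.
apply: (supported_ext cS oneS) => n.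
rewrite -(addNr m') conv_grid //; under eq_bigr => i _ do rewrite gE.
rewrite bP addNr /gridpt add0r mulf_eq0 invr_eq0 !pnatr_eq0.
by rewrite [N == 0%N]gtn_eqF // orbF.
Qed.

Lemma pmulVf x : x != 0 -> pinv x * x = 1.
Proof. by move=> /pinv_ex /(xgetPex 0). Qed.

Lemma pinv0 : pinv 0 = 0.
Proof.
rewrite /pinv; case: xgetP => // y _ /eqP.
by rewrite mulr0 eq_sym oner_eq0.
Qed.

HB.instance Definition _ := GRing.ComNzRing_isField.Build (puiseux K) pmulVf pinv0.

Definition pvar : puiseux K := pmono 1.

Lemma powerseries_laurent (a : nat -> K) : fractional_laurent
  (fun r : rat => if r \is a Num.nat then a (Num.truncn r) else 0).
Proof.
exists 1%N, 0; split=> // r; case: natrP => [[n ->] _|]; last by rewrite eqxx.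
by exists n%:Z; rewrite // divr1 -pmulrn.
Qed.

(* The generating function [\sum_n a_n z^n]. *)
Definition powerseries (a : nat -> K) : puiseux K :=
  Puiseux (powerseries_laurent a).

Definition is_fractional_powerseries x : Prop :=
  forall r : rat, r < 0 -> pcoef x r = 0.

End PuiseuxField.

Arguments pvar {K}.

Inductive step := North | East.

Definition bool_of_step s := if s is North then true else false.
Definition step_of_bool b := if b then North else East.
Lemma bool_of_stepK : cancel bool_of_step step_of_bool. Proof. by case. Qed.

HB.instance Definition _ := Finite.copy step (can_type bool_of_stepK).

Definition endpoint (p : seq step) : nat * nat :=
  (count_mem East p, count_mem North p).

(* Meant for paths with the same endpoint: their points after [i] steps lie on
   a common antidiagonal, so heights may be compared step by step. *)
Definition never_above (p P : seq step) : bool :=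
  [forall i : 'I_(size p).+1,
     count_mem North (take i p) <= count_mem North (take i P)]%N.

Definition staircase (k l n : nat) : seq step :=
  flatten (nseq n (nseq k North ++ nseq l East)).

(* A path ending at [(l * n, k * n)] has exactly [l * n + k * n] steps. *)
Definition qpaths (k l n : nat) : nat :=
  #|[set p : (l * n + k * n).-tuple step |
      (endpoint p == (l * n, k * n)%N) && never_above p (staircase k l n)]%SET|.

(* Main.v *)
(* Write u = w - 1 and let F_n(y) mark by y the final vertical distance from a path
   of (k + l) n steps to the staircase. Appending a block N^k E^l to the staircase
   gives y^l F_(n+1) = (1 + y)^(k+l) F_n - H_n, where deg H_n < l and
   H_n(0) = F_n(0) = q_n. This is the kernel method: if u has no negative powers and
   u^l = z (1 + u)^(k+l), then iterating the recurrence leaves a remainder divisible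
   by z^M for every M, so u is a root of T(y) = y^l - z sum_n H_n(y) z^n, which is
   monic of degree l in y. Writing u = z^(1/l) a, the equation becomes
   a^l = (1 + z^(1/l) a)^(k+l), which Hensel lifting solves from each l-th root of
   unity. This gives l distinct roots, so T is the product of the y - u_i and there
   is no other small root; evaluating at y = 0 gives - z Q(z) = prod_i (1 - w_i). *)
Require Import Defs.
From HB Require Import structures.
From mathcomp Require Import all_boot all_order all_algebra.
From mathcomp Require Import separable cyclotomic.
From mathcomp Require Import boolp classical_sets fsbigop.
From mathcomp Require Import reals complex.
From mathcomp Require Import ring lra zify.
Set Implicit Arguments.
Unset Strict Implicit.
Unset Printing Implicit Defensive.
Import Order.TTheory GRing.Theory Num.Theory.
Local Open Scope ring_scope.

(** * Valuations, and series in a fixed root of z *)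

Section Puiseux.
Variable K : fieldType.
Implicit Types (x y : puiseux K) (a : nat -> K) (p : {poly K}).

Lemma pterm_laurent (c : K) (q : rat) :
  fractional_laurent (fun r => c * (r == q)%:R).
Proof.
have [N [m [N0 qS]]] := monomial_laurent K q.
exists N, m; split=> // r; rewrite mulf_eq0 negb_or => /andP[_]; exact: qS.
Qed.

Definition pterm (c : K) (q : rat) : puiseux K := Puiseux (pterm_laurent c q).

Lemma pcoef_termM c q x r : pcoef (pterm c q * x) r = c * pcoef x (r - q).
Proof.
rewrite [LHS]/= /conv (fsbigE [:: q]) //=; last first.
  by move=> p _; rewrite inE => /negPf ->; rewrite mulr0 mul0r.
by rewrite big_mkcond big_seq1 in_setT eqxx mulr1.
Qed.

Lemma pmonoE q : pmono K q = pterm 1 q.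
Proof. by apply: puiseux_ext => r /=; rewrite mul1r. Qed.

Lemma pcoef_monoM q x r : pcoef (pmono K q * x) r = pcoef x (r - q).
Proof. by rewrite pmonoE pcoef_termM mul1r. Qed.

Lemma pmonoD q q' : pmono K (q + q') = pmono K q * pmono K q'.
Proof.
by apply: puiseux_ext => r; rewrite pcoef_monoM /= subr_eq addrC.
Qed.

Lemma pmonoX q n : pmono K q ^+ n = pmono K (n%:R * q).
Proof.
elim: n => [|n IHn]; first by rewrite mul0r expr0.
by rewrite exprS IHn -pmonoD -natr1 mulrDl mul1r addrC.
Qed.

Definition pconst (c : K) : puiseux K := pterm c 0.

Lemma pcoef_constM c x r : pcoef (pconst c * x) r = c * pcoef x r.
Proof. by rewrite pcoef_termM subr0. Qed.

Fact pconst_is_zmod_morphism : zmod_morphism pconst.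
Proof. by move=> c d; apply: puiseux_ext => r /=; rewrite mulrBl. Qed.

Fact pconst_is_monoid_morphism : monoid_morphism pconst.
Proof.
split=> [|c d]; apply: puiseux_ext => r; first by rewrite /= mul1r.
by rewrite pcoef_constM /= mulrA.
Qed.

HB.instance Definition _ :=
  GRing.isZmodMorphism.Build K (puiseux K) pconst pconst_is_zmod_morphism.
HB.instance Definition _ :=
  GRing.isMonoidMorphism.Build K (puiseux K) pconst pconst_is_monoid_morphism.

(** Only lower bounds on the valuation occur, so the zero series needs no separate case. *)
Definition val_ge (q : rat) x : Prop := forall r, r < q -> pcoef x r = 0.

Lemma val_geD q x y : val_ge q x -> val_ge q y -> val_ge q (x + y).
Proof. by move=> xq yq r rq; rewrite /= xq // yq // addr0. Qed.

Lemma val_geN q x : val_ge q x -> val_ge q (- x).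
Proof. by move=> xq r rq; rewrite /= xq // oppr0. Qed.

Lemma val_geM q q' x y : val_ge q x -> val_ge q' y -> val_ge (q + q') (x * y).
Proof.
move=> xq yq r rq; apply: fsbig1 => p _; have [pq|qp] := ltP p q.
  by rewrite xq // mul0r.
by rewrite yq ?mulr0 //; lra.
Qed.

Lemma val_geM0 q x y : val_ge q x -> val_ge 0 y -> val_ge q (x * y).
Proof. by rewrite -{2}[q]addr0; exact: val_geM. Qed.

Lemma val_ge_mono q : val_ge q (pmono K q).
Proof. by move=> r rq; rewrite /= lt_eqF. Qed.

Lemma val_ge_const c : val_ge 0 (pconst c).
Proof. by move=> r r0; rewrite /= lt_eqF // mulr0. Qed.

Lemma val_ge_exp x n : val_ge 0 x -> val_ge 0 (x ^+ n).
Proof.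
move=> x0; elim: n => [|n IHn]; first exact: (val_ge_mono (q := 0)).
by rewrite exprS; exact: val_geM0.
Qed.

Lemma val_ge_sum (I : Type) (s : seq I) (P : pred I) q (F : I -> puiseux K) :
  (forall i, P i -> val_ge q (F i)) -> val_ge q (\sum_(i <- s | P i) F i).
Proof.
move=> Fq; apply: (big_ind (val_ge q)) => //; exact: val_geD.
Qed.

Lemma val_ge_horner p x : val_ge 0 x -> val_ge 0 (map_poly pconst p).[x].
Proof.
move=> x0; rewrite horner_coef; apply: val_ge_sum => i _.
by rewrite coef_map; apply: val_geM0; [exact: val_ge_const|exact: val_ge_exp].
Qed.

(** Turns approximation to every order into equality. Both identities between infinite series below,
    for the lifted branch and for the roots of [kernel_poly], are proved through it. *)
Lemma val_ge_eq0 N x :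
  (0 < N)%N -> (forall n : nat, val_ge (n%:R / N%:R) x) -> x = 0.
Proof.
move=> N0 xq; apply: puiseux_ext => r; have NN0 : 0 < N%:R :> rat by rewrite ltr0n.
apply: (xq (Num.truncn (r * N%:R)).+1).
by rewrite ltr_pdivlMr // truncnS_gt.
Qed.

Definition gridseries_coef N a (r : rat) : K :=
  if r * N%:R \is a Num.nat then a (Num.truncn (r * N%:R)) else 0.

Lemma gridseries_laurent N a :
  fractional_laurent (gridseries_coef N.+1 a).
Proof.
exists N.+1, 0; split=> // r; rewrite /gridseries_coef.
case: natrP => [[n rn] _|]; last by rewrite eqxx.
by exists n%:Z => //; rewrite -pmulrn -rn mulfK ?pnatr_eq0.
Qed.

(* [\sum_n a_n z^(n / (N + 1))] *)
Definition gridseries N a : puiseux K := Puiseux (gridseries_laurent N a).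

Lemma powerseriesE a : powerseries a = gridseries 0 a.
Proof. by apply: puiseux_ext => r; rewrite /= /gridseries_coef mulr1. Qed.

Lemma gridseries_ge0 N a : val_ge 0 (gridseries N a).
Proof.
move=> r r0 /=; rewrite /gridseries_coef ifN //; apply/negP => /natr_ge0.
by rewrite pmulr_lge0 ?ltr0n // leNgt r0.
Qed.

Lemma gridseries_shift N a :
  gridseries N a =
  pconst (a 0%N) + pmono K N.+1%:R^-1 * gridseries N (fun n => a n.+1).
Proof.
have NN0 : N.+1%:R != 0 :> rat by rewrite pnatr_eq0.
apply: puiseux_ext => r.
rewrite [RHS](_ : _ = a 0%N * (r == 0)%:R
  + pcoef (pmono K N.+1%:R^-1 * gridseries N (fun n => a n.+1)) r) //.
rewrite pcoef_monoM /= /gridseries_coef mulrBl mulVf //.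
(* Scaling [r == 0] by [N.+1] expresses all three terms through the same number [r * N.+1%:R]. *)
rewrite -[r == 0](inj_eq (mulIf NN0)) mul0r.
case: natrP => [[[|n] ->]|rN].
- have /negPf n1 : 0 - 1 \isn't a @Num.nat rat.
    by apply/negP => /natr_ge0; rewrite sub0r oppr_ge0 ler10.
  by rewrite natrK eqxx mulr1 n1 addr0.
- by rewrite pnatr_eq0 mulr0 add0r -natr1 addrK rpred_nat natr1 !natrK.
- case: eqP => [r0|_]; first by case: rN; exists 0%N.
  rewrite mulr0 add0r ifN //; apply/negP => /natrP[m rm].
  by case: rN; exists m.+1; rewrite -[m.+1%:R]natr1; apply/eqP; rewrite -subr_eq rm.
Qed.

Lemma gridseries_split N n a :
  gridseries N a =
  (map_poly pconst (\poly_(i < n) a i)).[pmono K N.+1%:R^-1]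
  + pmono K N.+1%:R^-1 ^+ n * gridseries N (fun m => a (n + m)%N).
Proof.
elim: n => [|n IHn].
  by rewrite poly_def big_ord0 rmorph0 horner0 add0r mul1r.
rewrite [LHS]IHn gridseries_shift !poly_def big_ord_recr /=.
rewrite rmorphD /= hornerD -addrA mulrDr; congr (_ + (_ + _)).
  by rewrite map_polyZ map_polyXn hornerZ hornerXn mulrC addn0.
rewrite mulrA -exprSr; congr (_ * gridseries _ _).
by apply/funext => m; rewrite addSnnS.
Qed.

(** Transfers polynomial congruences modulo ['X^n] to series, with the root of z substituted for
    ['X]. *)
Lemma gridseries_approx N n a :
  val_ge (n%:R / N.+1%:R)
    (gridseries N a - (map_poly pconst (\poly_(i < n) a i)).[pmono K N.+1%:R^-1]).
Proof.
rewrite (gridseries_split N n) addrC addKr pmonoX.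
by apply: val_geM0; [exact: val_ge_mono|exact: gridseries_ge0].
Qed.

End Puiseux.

(** * Hensel lifting of roots of unity *)

Lemma exprD_first_order (R : comNzRingType) (x d : R) n :
  exists e, (x + d) ^+ n = x ^+ n + n%:R * x ^+ n.-1 * d + d ^+ 2 * e.
Proof.
elim: n => [|n [e IHn]]; first by exists 0; rewrite !expr0; ring.
exists (x * e + n%:R * x ^+ n.-1 + d * e).
rewrite exprS IHn -[n.+1.-1]/n.
case: n {IHn} => [|n]; first by rewrite /= !expr0 expr1; ring.
by rewrite -[n.+1.-1]/n !exprS -[n.+2%:R]natr1; ring.
Qed.

Section Hensel.
Variables (K : fieldType) (l m : nat).

(** Substituting w = 1 + t x with t^l = z into (w - 1)^l = z w^m and dividing by z leaves this
    expression. The ring is generic because t is first the indeterminate ['X], then a root of z. *)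
Definition branch_eq (R : comNzRingType) (t x : R) := x ^+ l - (1 + t * x) ^+ m.

Lemma factorX (p : {poly K}) : p.[0] = 0 -> exists q, p = 'X * q.
Proof.
move=> /eqP /factor_theorem[q ->]; exists q.
by rewrite subr0 mulrC.
Qed.

(** At t = 0 the derivative in x is l a0^(l-1), which is invertible, so [c] is the Newton
    correction. The power of 1 + t x does not affect its choice: there the correction is multiplied
    by a further t. *)
Lemma hensel_step (a0 : K) (B e : {poly K}) n :
  l%:R * a0 ^+ l.-1 != 0 -> B.[0] = a0 -> branch_eq 'X B = 'X^(n.+1) * e ->
  exists c e', branch_eq 'X (B + c *: 'X^(n.+1)) = 'X^(n.+2) * e'.
Proof.
move=> la0 Ba0 Be; set c := - e.[0] / (l%:R * a0 ^+ l.-1).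
have [e1 E1] := exprD_first_order B (c *: 'X^(n.+1)) l.
have [e2 E2] := exprD_first_order (1 + 'X * B) ('X * (c *: 'X^(n.+1))) m.
have [q qE] : exists q, e + l%:R * B ^+ l.-1 * c%:P = 'X * q.
  apply: factorX; rewrite !hornerE Ba0 /c.
  rewrite (_ : l%:R.[0] = l%:R :> K); last by rewrite -polyC_natr hornerC.
  by rewrite /= mulrAC divff // mul1r subrr.
exists c.
(* In order: what is left after cancelling the constant term, the quadratic remainder of the l-th
   power, then the linear and quadratic parts of the m-th power. *)
exists (q + 'X^n * (c%:P ^+ 2 * e1) - m%:R * (1 + 'X * B) ^+ m.-1 * c%:P
        - 'X^n * 'X * 'X * c%:P ^+ 2 * e2).
have {}Be : B ^+ l = 'X^(n.+1) * e + (1 + 'X * B) ^+ m by rewrite -Be /branch_eq subrK.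
have {}qE : e = 'X * q - l%:R * B ^+ l.-1 * c%:P by rewrite -qE addrK.
rewrite /branch_eq (mulrDr 'X) addrA E1 E2 Be qE -!mul_polyC !(exprS 'X).
ring.
Qed.

Lemma hensel_series (a0 : K) : a0 ^+ l = 1 -> l%:R != 0 :> K ->
  exists a : nat -> K, a 0%N = a0 /\
  forall n, exists e, branch_eq 'X (\poly_(i < n) a i) = 'X^n * e.
Proof.
move=> a0l l0.
have la0 : l%:R * a0 ^+ l.-1 != 0.
  rewrite mulf_neq0 //; apply: expf_neq0; apply/eqP => a00.
  move: a0l l0; rewrite a00; case: (l) => [|n]; rewrite ?eqxx // expr0n.
  by move=> /eqP; rewrite eq_sym oner_eq0.
pose good n B := B.[0] = a0 /\ exists e, branch_eq 'X B = 'X^(n.+1) * e.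
(* The correction depends on the current approximation as well as on the order, so the choice is
   made over pairs. *)
have /choice[c cP] : forall Bn : {poly K} * nat, exists c : K,
    good Bn.2 Bn.1 -> good Bn.2.+1 (Bn.1 + c *: 'X^(Bn.2.+1)).
  move=> [B n] /=; have [[Ba0 [e Be]]|nB] := pselect (good n B); last by exists 0.
  have [c cP] := hensel_step la0 Ba0 Be; exists c => _; split=> //.
  by rewrite !hornerE /= expr0n /= mulr0 addr0.
pose B := fix B n := if n is n'.+1 then B n' + c (B n', n') *: 'X^n else a0%:P.
pose a n := if n is n'.+1 then c (B n', n') else a0.
have BE n : B n = \poly_(i < n.+1) a i.
  elim: n => [|n IHn].
    by rewrite poly_def big_ord_recl big_ord0 addr0 expr0 alg_polyC.
  by rewrite poly_def big_ord_recr -poly_def -IHn.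
exists a; split=> // -[|n].
  by exists (branch_eq 'X (\poly_(i < 0) a i)); rewrite mul1r.
rewrite -BE; suff [] : good n (B n) by [].
elim: n => [|n IHn]; last exact: (cP (B n, n)).
split; first by rewrite hornerC.
apply: factorX; rewrite /branch_eq !hornerE /=.
by rewrite a0l expr1n subrr.
Qed.

End Hensel.

(** * The branch attached to a root of unity *)

Section Branch.
Variables (K : fieldType) (N m : nat).
Let l := N.+1.
Let s : puiseux K := pmono K l%:R^-1.

(** The coefficient of z^(1/l) in x - 1 is recorded because it tells the branches of different roots
    of unity apart. *)
Lemma branch_exists (a0 : K) : a0 ^+ l = 1 -> l%:R != 0 :> K ->
  exists2 x : puiseux K, is_fractional_powerseries x /\
    (x - 1) ^+ l - pvar * x ^+ m = 0 & pcoef (x - 1) l%:R^-1 = a0.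
Proof.
move=> a0l l0; have [a [aa0 aP]] := hensel_series m a0l l0.
pose A := gridseries N a.
have A0 : val_ge 0 A by exact: gridseries_ge0.
have s0 : val_ge 0 s.
  by move=> r r0; apply: val_ge_mono; rewrite (lt_le_trans r0) ?invr_ge0.
have O1 : val_ge (0 : rat) (1 : puiseux K) by exact: val_ge_mono.
have sl : s ^+ l = pvar by rewrite /s pmonoX mulfV // pnatr_eq0.
have AP : branch_eq l m s A = 0.
  apply: (@val_ge_eq0 K l) => // n; have [e eP] := aP n.
  pose P := (map_poly (@pconst K) (\poly_(i < n) a i)).[s].
  have P0 : val_ge 0 P by exact: val_ge_horner.
  have dAP : val_ge (n%:R / l%:R) (A - P) by exact: gridseries_approx.
  have PE : branch_eq l m s P = s ^+ n * (map_poly (@pconst K) e).[s].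
    have := congr1 (fun p => (map_poly (@pconst K) p).[s]) eP.
    rewrite /branch_eq !(rmorphB, rmorphM, rmorphXn, rmorphD, rmorph1) /= !map_polyX.
    by rewrite !hornerE.
  (* The value at the truncation [P] has a factor s^n. The change from [P] to [A] has the valuation
     of [A - P] at least, since a difference of equal powers is divisible by the difference of the
     bases. *)
  rewrite -[branch_eq l m s A](subrK (branch_eq l m s P)); apply: val_geD.
    rewrite [X in val_ge _ X](_ : _ = (A ^+ l - P ^+ l) -
       ((1 + s * A) ^+ m - (1 + s * P) ^+ m)); last by rewrite /branch_eq; ring.
    have pw (x y : puiseux K) q n' : val_ge 0 x -> val_ge 0 y -> val_ge q (x - y) ->
        val_ge q (x ^+ n' - y ^+ n').
      move=> x0 y0 xy; rewrite subrXX; apply: val_geM0 => //; apply: val_ge_sum => i _.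
      by apply: val_geM0; exact: val_ge_exp.
    apply: val_geD; first exact: pw.
    apply/val_geN/pw.
    - by apply: val_geD => //; apply: val_geM0.
    - by apply: val_geD => //; apply: val_geM0.
    - by rewrite opprD addrACA subrr add0r -mulrBr [s * _]mulrC; apply: val_geM0.
  rewrite PE /s pmonoX; apply: val_geM0; first exact: val_ge_mono.
  exact: val_ge_horner.
exists (1 + s * A).
  split; first by apply: (@val_geD _ 0) => //; exact: val_geM0.
  rewrite [_ - 1]addrC addKr exprMn sl -mulrBr.
  by move: AP; rewrite /branch_eq => ->; rewrite mulr0.
rewrite [_ - 1]addrC addKr pcoef_monoM subrr /A /= /gridseries_coef mul0r.
by rewrite (_ : 0 = 0%:R) // rpred_nat natrK.
Qed.
End Branch.

(** * Paths weakly below a word *)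

Local Notation north := (count_mem North).

Lemma never_aboveP (p P : seq step) :
  reflect (forall i, (i <= size p)%N -> (north (take i p) <= north (take i P))%N)
          (never_above p P).
Proof.
apply: (iffP forallP) => [pP i ip|pP i]; last by apply: pP; rewrite -ltnS.
by have := pP (Ordinal (n := (size p).+1) ip).
Qed.

Lemma never_above_count p P :
  size p = size P -> never_above p P -> (north p <= north P)%N.
Proof.
move=> pP /never_aboveP/(_ (size p) (leqnn _)).
by rewrite take_size pP take_size.
Qed.

(** Shorter prefixes do not see the appended letters, so the only new constraint is the one at full
    length. *)
Lemma never_above_rcons p P a b : size p = size P ->
  never_above (rcons p a) (rcons P b) =
  never_above p P && (north (rcons p a) <= north (rcons P b))%N.
Proof.
move=> pP; apply/never_aboveP/andP => [na|[/never_aboveP na nab] i].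
  split; last first.
    have := na (size (rcons p a)) (leqnn _).
    by rewrite take_size !size_rcons pP -(size_rcons P b) take_size.
  apply/never_aboveP => i ip; have := na i.
  by rewrite size_rcons -!cats1 !takel_cat -?pP //; apply; exact: leqW.
rewrite size_rcons leq_eqVlt ltnS => /orP[/eqP->|ip].
  by rewrite -{1}(size_rcons p a) take_size pP -(size_rcons P b) take_size.
by rewrite -!cats1 !takel_cat -?pP //; exact: na.
Qed.

Lemma big_tuple_rcons (V : nmodType) (T : finType) n (F : n.+1.-tuple T -> V) :
  \sum_t F t = \sum_(t : n.-tuple T) \sum_a F [tuple of rcons t a].
Proof.
pose f (x : n.-tuple T * T) := [tuple of rcons x.1 x.2] : n.+1.-tuple T.
rewrite pair_big (reindex f) //=; apply/onW_bij.
apply: inj_card_bij => [[t a] [t' a']|].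
  move=> /(congr1 val) /= /rcons_inj[tt ->]; congr pair; exact: val_inj.
by rewrite card_prod !card_tuple expnSr.
Qed.

Lemma big_step (V : nmodType) (F : step -> V) : \sum_a F a = F North + F East.
Proof. by rewrite (bigD1 North) //= (big_pred1 East) //; case. Qed.

Lemma nseqSr (T : Type) n (x : T) : nseq n.+1 x = rcons (nseq n x) x.
Proof. by rewrite -addn1 nseqD cats1. Qed.

(** * Path polynomials and the staircase recurrence *)

Section PathPoly.
Variable K : comNzRingType.

(* [P] being a word, [size p = size P] makes the endpoints of [p] and [P] lie on a
   common antidiagonal; the subtraction never truncates, by [never_above]. *)
Definition path_poly (P : seq step) : {poly K} :=
  \sum_(p : (size P).-tuple step | never_above p P) 'X^(north P - north p).

Lemma path_polyE n P : size P = n ->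
  path_poly P = \sum_(p : n.-tuple step | never_above p P) 'X^(north P - north p).
Proof. by move=> <-. Qed.

Lemma path_poly_rcons P b :
  path_poly (rcons P b) =
  \sum_(p : (size P).-tuple step | never_above p P)
    \sum_(a | (north (rcons p a) <= north (rcons P b))%N)
       'X^(north (rcons P b) - north (rcons p a)).
Proof.
rewrite (path_polyE (size_rcons P b)) big_mkcond big_tuple_rcons [RHS]big_mkcond.
apply: eq_bigr => p _ /=.
have [pP|pP] := boolP (never_above p P); last first.
  by rewrite big1 // => a _; rewrite never_above_rcons ?size_tuple // (negPf pP).
rewrite [RHS]big_mkcond; apply: eq_bigr => a _.
by rewrite never_above_rcons ?size_tuple // pP.
Qed.

Lemma north_rcons p a : north (rcons p a) = (north p + (a == North))%N.
Proof. by rewrite -cats1 count_cat /= addn0. Qed.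

(** Against a North step of the boundary, a North step of the path keeps the distance and an East
    step raises it by one; both are always allowed. *)
Lemma path_poly_north P : path_poly (rcons P North) = (1 + 'X) * path_poly P.
Proof.
rewrite path_poly_rcons /path_poly mulr_sumr; apply: eq_bigr => p pP.
have := never_above_count (size_tuple p) pP.
rewrite big_mkcond big_step !north_rcons eqxx /= => le_pP.
rewrite leq_add2r le_pP addn0 !addn1 leqW // subSS subSn //.
by rewrite mulrDl mul1r exprS.
Qed.

(** Against an East step of the boundary, an East step keeps the distance and a North step lowers it
    by one. The North step is forbidden exactly at distance zero, and the subtracted constant counts
    those paths. *)
Lemma path_poly_east P :
  'X * path_poly (rcons P East) = (1 + 'X) * path_poly P - ((path_poly P).[0])%:P.
Proof.
rewrite path_poly_rcons /path_poly !mulr_sumr horner_sum rmorph_sum -sumrB.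
apply: eq_bigr => p pP.
have := never_above_count (size_tuple p) pP.
rewrite big_mkcond big_step !north_rcons eqxx /= !addn0 addn1 => le_pP.
rewrite le_pP hornerXn mulrDr mulrDl mul1r.
have [lt_pP|ge_pP] := ltnP.
  by rewrite -exprS -subSn // subSS expr0n subn_eq0 leqNgt lt_pP subr0.
have -> : (north P - north p = 0)%N by apply/eqP; rewrite subn_eq0.
by rewrite !expr0 mulr0 add0r [1 + _]addrC addrK.
Qed.

Lemma path_poly_nseq_north P k :
  path_poly (P ++ nseq k North) = (1 + 'X) ^+ k * path_poly P.
Proof.
elim: k => [|k IHk]; first by rewrite cats0 mul1r.
by rewrite nseqSr -rcons_cat path_poly_north IHk mulrA exprS.
Qed.

Lemma path_poly_nseq_east P l : exists H : {poly K}, (size H <= l)%N /\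
  'X^l * path_poly (P ++ nseq l East) = (1 + 'X) ^+ l * path_poly P - H.
Proof.
elim: l => [|l [H [Hl IHl]]].
  by exists 0; rewrite size_poly0 cats0 subr0.
set c := (path_poly (P ++ nseq l East)).[0].
(* The old remainder is multiplied by 1 + X and the new constant by X^l, so the degree bound grows
   by one. *)
exists ((1 + 'X) * H + 'X^l * c%:P); split.
  rewrite (leq_trans (size_polyD _ _)) // geq_max; apply/andP; split.
    by rewrite (leq_trans (size_polyMleq _ _)) // addrC size_XaddC.
  by rewrite mulrC mul_polyC (leq_trans (size_scale_leq _ _)) // size_polyXn.
rewrite nseqSr -rcons_cat exprSr -mulrA path_poly_east -/c.
rewrite mulrBr mulrCA IHl exprS; ring.
Qed.

Lemma staircaseS k l n :
  staircase k l n.+1 = (staircase k l n ++ nseq k North) ++ nseq l East.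
Proof.
by rewrite /staircase nseqSr -cats1 flatten_cat /= cats0 catA.
Qed.

Lemma staircase_rec k l : exists H : nat -> {poly K}, forall n,
  (size (H n) <= l)%N /\
  'X^l * path_poly (staircase k l n.+1) =
  (1 + 'X) ^+ (k + l) * path_poly (staircase k l n) - H n.
Proof.
suff /choice[H HP] : forall n, exists H : {poly K}, (size H <= l)%N /\
    'X^l * path_poly (staircase k l n.+1) =
    (1 + 'X) ^+ (k + l) * path_poly (staircase k l n) - H by exists H.
move=> n; have [H [Hl HE]] := path_poly_nseq_east (staircase k l n ++ nseq k North) l.
exists H; split=> //.
by rewrite staircaseS HE path_poly_nseq_north mulrA -exprD addnC.
Qed.

Lemma path_poly_nil : path_poly [::] = 1.
Proof.
rewrite /path_poly (big_pred1 [tuple]) // => p.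
by rewrite tuple0; apply/never_aboveP => -[].
Qed.

Lemma north_staircase k l n : north (staircase k l n) = (k * n)%N.
Proof.
elim: n => [|n IHn]; first by rewrite muln0.
by rewrite staircaseS !count_cat IHn !count_nseq /=; lia.
Qed.

Lemma size_staircase k l n : size (staircase k l n) = (l * n + k * n)%N.
Proof.
elim: n => [|n IHn]; first by rewrite !muln0.
by rewrite staircaseS !size_cat IHn !size_nseq; lia.
Qed.

Lemma count_east p : count_mem East p = (size p - north p)%N.
Proof.
by rewrite -(count_predC (pred1 North)) addKn; apply: eq_count => -[].
Qed.

(** Evaluation at 0 keeps the paths at distance zero. As all lengths agree, these are the paths with
    the endpoint of the staircase. *)
Lemma qpathsE k l n : (qpaths k l n)%:R = (path_poly (staircase k l n)).[0].
Proof.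
rewrite (path_polyE (size_staircase k l n)) horner_sum /qpaths -sum1_card natr_sum.
rewrite big_mkcond [RHS]big_mkcond; apply: eq_bigr => p _.
rewrite inE; have [pP|_] := boolP (never_above p _); last by rewrite andbF.
have := never_above_count _ pP; rewrite size_tuple size_staircase => /(_ erefl).
have := count_size (pred1 North) p; rewrite size_tuple => le_p.
rewrite /endpoint xpair_eqE count_east size_tuple north_staircase => le_pP.
rewrite hornerXn expr0n subn_eq0 andbT.
rewrite (_ : (_ && _) = (k * n <= north p)%N); first by case: leqP.
apply/andP/idP => [[_ /eqP ->] //|ge_pP].
have -> : north p = (k * n)%N by apply/eqP; rewrite eqn_leq le_pP.
by rewrite addnK !eqxx.
Qed.
End PathPoly.

(** * The kernel polynomial and its roots *)

Section Kernel.
Variables (K : fieldType) (k l : nat).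
Hypothesis l_gt0 : (0 < l)%N.
Variable H : nat -> {poly K}.
Hypothesis size_H : forall n, (size (H n) <= l)%N.
Hypothesis H_rec : forall n,
  'X^l * path_poly K (staircase k l n.+1) =
  (1 + 'X) ^+ (k + l) * path_poly K (staircase k l n) - H n.

Let z : puiseux K := pvar.
Let Hseries j := powerseries (fun n => (H n)`_j).

Definition small_solution (x : puiseux K) : Prop :=
  is_fractional_powerseries x /\ (x - 1) ^+ l - z * x ^+ (k + l) = 0.

(** This is T, regrouped by powers of y so that each coefficient is a single series in z. *)
Definition kernel_poly : {poly puiseux K} :=
  'X^l - \poly_(j < l) (z * Hseries j).

(** The recurrence at y = u, multiplied by z^(M+1), telescopes because u^l equals z (1 + u)^(k+l);
    the remainder is exact. *)
Lemma kernel_poly_partial (u : puiseux K) M :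
  u ^+ l = z * (1 + u) ^+ (k + l) ->
  u ^+ l - z * (\sum_(n < M) z ^+ n * (map_poly (@pconst K) (H n)).[u]) =
  z ^+ M * (u ^+ l * (map_poly (@pconst K) (path_poly K (staircase k l M))).[u]).
Proof.
move=> uE; elim: M => [|M IHM].
  by rewrite big_ord0 mulr0 subr0 path_poly_nil rmorph1 hornerC mulr1 mul1r.
rewrite big_ord_recr /= mulrDr opprD addrA IHM.
have recM := congr1 (fun p => (map_poly (@pconst K) p).[u]) (H_rec M).
rewrite !(rmorphB, rmorphM, rmorphXn, rmorphD, rmorph1) /= !map_polyX !hornerE in recM.
rewrite recM.
by rewrite {1}uE exprS; ring.
Qed.

Lemma kernel_poly_root x : small_solution x -> root kernel_poly (x - 1).
Proof.
move=> [x0 xE]; set u := x - 1.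
have u0 : val_ge 0 u.
  by apply: (@val_geD _ 0) => //; apply/val_geN/(@val_ge_mono K 0).
have uE : u ^+ l = z * (1 + u) ^+ (k + l).
  by rewrite /u subrKC; apply/eqP; rewrite -subr_eq0 xE.
apply/rootP/(@val_ge_eq0 K 1) => // M; rewrite divr1.
have zM : val_ge M%:R (z ^+ M) by rewrite pmonoX mulr1; exact: val_ge_mono.
have z0 : val_ge 0 z.
  by move=> r r0; apply: val_ge_mono; exact: lt_trans r0 _.
(* Splits T(u) into the exact remainder of the partial sum, divisible by z^M, and the error of
   truncating the series in T. *)
rewrite -[_.[u]](subrK (z ^+ M *
  (u ^+ l * (map_poly (@pconst K) (path_poly K (staircase k l M))).[u]))).
apply: val_geD; last first.
  apply: val_geM0 => //; apply: val_geM0; first exact: val_ge_exp.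
  exact: val_ge_horner.
rewrite -kernel_poly_partial // /kernel_poly hornerD hornerN hornerXn horner_poly.
rewrite opprD opprK addrACA subrr add0r addrC mulr_sumr.
under eq_bigr => n _.
  rewrite (@horner_coef_wide _ l); last exact: leq_trans (size_poly _ _) (size_H n).
  rewrite !mulr_sumr; over.
(* After the exchange, the term of index j is, up to sign, z u^j times the truncation error of
   [Hseries j]. *)
rewrite exchange_big -sumrB; apply: val_ge_sum => j _.
have := @gridseries_approx K 0 M (fun n => (H n)`_j).
rewrite -powerseriesE -/(Hseries j) invr1 -/pvar -/z mulr1.
rewrite (@horner_coef_wide _ M); last by rewrite (leq_trans (size_poly _ _)) ?size_poly.
move=> apx.
rewrite -/(val_ge M%:R _).
set A := \sum_(i < M) _ in apx.
rewrite (_ : \sum_(n < M) _ = A * (z * u ^+ j)); last first.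
  rewrite mulr_suml; apply: eq_bigr => n _.
  by rewrite !coef_map coef_poly ltn_ord /=; ring.
rewrite [X in val_ge _ X](_ : _ = (Hseries j - A) * - (z * u ^+ j)); last by ring.
by apply: val_geM0 => //; apply/val_geN/val_geM0 => //; exact: val_ge_exp.
Qed.
Lemma size_kernel_poly : size kernel_poly = l.+1.
Proof. by rewrite size_polyDl size_polyXn // size_polyN ltnS size_poly. Qed.

Lemma kernel_poly_monic : kernel_poly \is monic.
Proof.
apply/monicP; rewrite lead_coefDl ?lead_coefXn //.
by rewrite size_polyN size_polyXn ltnS size_poly.
Qed.

(** The l shifted entries are distinct roots of a monic polynomial of degree l, so they exhaust its
    roots. *)
Lemma kernel_poly_factor (w : l.-tuple (puiseux K)) :
  uniq w -> (forall x, x \in w -> small_solution x) ->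
  kernel_poly = \prod_(x <- w) ('X - (x - 1)%:P).
Proof.
move=> uw wS; rewrite -(big_map (fun x => x - 1) xpredT (fun x => 'X - x%:P)).
rewrite {1}(@all_roots_prod_XsubC _ kernel_poly [seq x - 1 | x <- w]).
- by rewrite (monicP kernel_poly_monic) scale1r.
- by rewrite size_map size_tuple size_kernel_poly.
- by apply/allP => _ /mapP[x /wS xS ->]; exact: kernel_poly_root.
- by rewrite uniq_rootsE map_inj_uniq // => x y /addIr.
Qed.

Lemma small_solution_mem (w : l.-tuple (puiseux K)) :
  uniq w -> (forall x, x \in w -> small_solution x) ->
  forall x, small_solution x -> x \in w.
Proof.
move=> uw wS x /kernel_poly_root; rewrite (kernel_poly_factor uw wS).
rewrite -(big_map (fun x => x - 1) xpredT (fun x => 'X - x%:P)) root_prod_XsubC.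
by move=> /mapP[y yw /addIr ->].
Qed.

Lemma kernel_poly0 :
  kernel_poly.[0] = - (z * powerseries (fun n => (qpaths k l n)%:R)).
Proof.
rewrite /kernel_poly hornerD hornerN hornerXn expr0n gtn_eqF // add0r.
rewrite horner_coef0 coef_poly l_gt0 /Hseries; congr (- (z * powerseries _)).
apply/funext => n; rewrite qpathsE -horner_coef0.
(* At y = 0 the left side of the recurrence vanishes because l is positive, which gives H_n(0) =
   F_n(0). *)
have /(congr1 (horner^~ 0)) := H_rec n.
rewrite !hornerE expr0n gtn_eqF // mul0r expr1n mul1r => /esym/eqP.
by rewrite subr_eq0 => /eqP.
Qed.

Lemma powerseries_prod (w : l.-tuple (puiseux K)) :
  uniq w -> (forall x, x \in w -> small_solution x) ->
  powerseries (fun n => (qpaths k l n)%:R) = (-1) / z * \prod_(i < l) (1 - tnth w i).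
Proof.
move=> uw wS.
have z0 : z != 0.
  apply/eqP => /(congr1 (fun x => pcoef x 1)) /= /eqP.
  by apply/negP; exact: oner_neq0.
have := kernel_poly0; rewrite (kernel_poly_factor uw wS) horner_prod.
rewrite (eq_bigr (fun x => 1 - x)); last by move=> x _; rewrite !hornerE opprB.
rewrite big_tuple => ->.
by rewrite mulrAC mulN1r opprK mulrC mulKf.
Qed.
End Kernel.

(** * Existence of the l small solutions, and the formula *)

Lemma small_solutions_exist (K : fieldType) (k l : nat) (rs : seq K) :
  (0 < l)%N -> l%:R != 0 :> K -> size rs = l -> uniq rs ->
  (forall a, a \in rs -> a ^+ l = 1) ->
  exists w : l.-tuple (puiseux K),
    uniq w /\ forall x, x \in w -> small_solution k l x.
Proof.
case: l => // l _ l0 size_rs uniq_rs rs1.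
have /choice[f fP] : forall a : K, exists x : puiseux K, a \in rs ->
    small_solution k l.+1 x /\ pcoef (x - 1) l.+1%:R^-1 = a.
  move=> a; have [ars|_] := boolP (a \in rs); last by exists 0.
  by have [x xS xa] := branch_exists (k + l.+1) (rs1 a ars) l0; exists x.
have sz : size (map f rs) == l.+1 by rewrite size_map size_rs.
exists (Tuple sz); split=> [|_ /mapP[a ars ->]]; last by case: (fP a ars).
(* Distinct roots of unity give distinct solutions, since each root is read off as a coefficient of
   its solution. *)
rewrite map_inj_in_uniq // => a b ars brs fab.
by have [_ <-] := fP a ars; have [_ <-] := fP b brs; rewrite fab.
Qed.

Lemma unity_roots (F : closedFieldType) n : (0 < n)%N -> n%:R != 0 :> F ->
  exists rs : seq F, [/\ size rs = n, uniq rs & forall a, a \in rs -> a ^+ n = 1].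
Proof.
move=> n_gt0 n0; have [rs rsE] := closed_field_poly_normal ('X^n - 1 : {poly F}).
rewrite (monicP (monic_Xn_sub_1 _ n_gt0)) scale1r in rsE.
exists rs; split.
- by have := size_Xn_sub_1 F n_gt0; rewrite rsE size_prod_XsubC => -[].
(* Separability of X^n - 1, where n is nonzero in the field, makes the roots distinct. *)
- by rewrite -separable_prod_XsubC -rsE; exact: separable_Xn_sub_1.
- move=> a; rewrite -root_prod_XsubC -rsE => /rootP.
  by rewrite !hornerE => /eqP; rewrite subr_eq0 => /eqP.
Qed.

Theorem theorem1 (R : realType) (k l : nat) (k_gt0 : (0 < k)%N) (l_gt0 : (0 < l)%N) :
  let z : puiseux R[i] := pvar in
  let Q : puiseux R[i] := powerseries (fun n => (qpaths k l n)%:R) in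
  let solutions (w : l.-tuple (puiseux R[i])) : Prop :=
    uniq w /\
    forall x : puiseux R[i], x \in w <->
      is_fractional_powerseries x /\ (x - 1) ^+ l - z * x ^+ (k + l) = 0 in
  (exists w : l.-tuple (puiseux R[i]), solutions w) /\
  (forall w : l.-tuple (puiseux R[i]), solutions w ->
     Q = (-1) / z * \prod_(i < l) (1 - tnth w i)).
Proof.
move=> z Q solutions.
have [H HP] := staircase_rec R[i] k l.
have [size_H H_rec] : (forall n, (size (H n) <= l)%N) /\ _ :=
  conj (fun n => (HP n).1) (fun n => (HP n).2).
have l0 : l%:R != 0 :> R[i] by rewrite pnatr_eq0 -lt0n.
split=> [|w [uw wS]]; last first.
  by apply: (powerseries_prod l_gt0 size_H H_rec uw) => x /wS.
have [rs [size_rs uniq_rs rs1]] := unity_roots l_gt0 l0.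
have [w [uw wS]] := small_solutions_exist k l_gt0 l0 size_rs uniq_rs rs1.
exists w; split=> // x; split=> [/wS //|].
exact: (small_solution_mem size_H H_rec uw wS).
Qed.
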